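(* Let $f:\Theta\to Z$ be an SCF with $|f(\Theta)|\ge 2$. The following are equivalent: (i) $f$ is pure-Nash-implementable; (ii) $f$ is mixed-Nash-implementable; (iii) $f$ is double-Nash-implementable; (iv) $\widehat{\mathcal L}^Y$-monotonicity holds.
   Context: Standing setup: $\mathcal I=\{1,\dots,I\}$ finite, $I\ge 3$; $\Theta$ finite or countably infinite; $Z$ finite; $Y=\Delta(Z)$ with $z\in Z$ identified with degenerate lotteries; $u_i^\theta:Z\to\mathbb R$, $U_i^\theta(y)=\sum_z y_zu_i^\theta(z)$; $\mathcal L_i^Y(\alpha,\theta)=\{y\in Y:U_i^\theta(\alpha)\ge U_i^\theta(y)\}$, $\mathcal L_i^Z(\alpha,\theta)=\{z\in Z:U_i^\theta(\alpha)\ge u_i^\theta(z)\}$. A mechanism $\mathcal M=\langle M=\times_iM_i,g:M\to Y\rangle$ has countable $M_i$; $g(\lambda)$ is the lottery induced by a profile $\lambda$; $PNE^{(\mathcal M,\theta)}$, $MNE^{(\mathcal M,\theta)}$ are the pure and mixed Nash equilibria at $\theta$ (w.r.t. $U_i^\theta$). $f$ is mixed-Nash-implementable (resp. pure-Nash-implementable) if there is $\mathcal M$ with $\bigcup_{\lambda\in MNE^{(\mathcal M,\theta)}}\mathrm{SUPP}(g[\lambda])=\{f(\theta)\}$ (resp. with $PNE$ in place of $MNE$) for all $\theta$; double-Nash-implementable if there is $\mathcal M$ with both unions (over $MNE$ and over $PNE$) equal to $\{f(\theta)\}$ for all $\theta$. A nonempty $E\subseteq Z$ is an $i$-$\theta$-max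 set if $E\subseteq\arg\max_{z\in E}u_i^\theta(z)$ and $E\subseteq\arg\max_{z\in Z}u_j^\theta(z)$ for all $j\ne i$; an $i$-max set if it is such for some $\theta$. $\widehat{\mathcal L}_i^Y(a,\theta)=\{a\}$ if $a=f(\theta)\in\arg\min_{z\in Z}u_i^\theta(z)$ and $\mathcal L_i^Z(f(\theta),\theta)$ is an $i$-max set; otherwise $\mathcal L_i^Y(a,\theta)$. $\widehat{\mathcal L}^Y$-monotonicity: for all $\theta,\theta'$, [$\widehat{\mathcal L}_i^Y(f(\theta),\theta)\subseteq\mathcal L_i^Y(f(\theta),\theta')$ for all $i$] implies $f(\theta)=f(\theta')$. *)

(* Defs.v *)
From HB Require Import structures.
From mathcomp Require Import all_boot all_order all_algebra.
From mathcomp Require Import all_classical all_reals ereal esum.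
Set Implicit Arguments. Unset Strict Implicit. Unset Printing Implicit Defensive.
Import Order.TTheory GRing.Theory Num.Theory.
Local Open Scope ring_scope.

Section Impl.
(* R : the reals; n : number of agents (agents are 'I_n); Theta : states;
   Z : outcomes; u i th z = u_i^th(z). *)
Variables (R : realType) (n : nat) (Theta : countType) (Z : finType)
  (u : 'I_n -> Theta -> Z -> R).

Definition is_lottery (y : Z -> R) : Prop :=
  (forall z, 0 <= y z) /\ \sum_(z : Z) y z = 1.

Definition delta (a : Z) : Z -> R := fun z => if z == a then 1 else 0.

Definition U (i : 'I_n) (th : Theta) (y : Z -> R) : R :=
  \sum_(z : Z) y z * u i th z.

Definition LY (i : 'I_n) (alpha : Z -> R) (th : Theta) (y : Z -> R) : Prop :=
  is_lottery y /\ U i th y <= U i th alpha.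

Definition LZ (i : 'I_n) (alpha : Z -> R) (th : Theta) : {set Z} :=
  [set z | u i th z <= U i th alpha].

Definition is_i_th_max_set (i : 'I_n) (th : Theta) (E : {set Z}) : Prop :=
  (exists z, z \in E) /\
  (forall z, z \in E -> forall z', z' \in E -> u i th z' <= u i th z) /\
  (forall j, j != i -> forall z, z \in E -> forall z' : Z, u j th z' <= u j th z).

Definition is_i_max_set (i : 'I_n) (E : {set Z}) : Prop :=
  exists th, is_i_th_max_set i th E.

Definition LYhat (f : Theta -> Z) (i : 'I_n) (a : Z) (th : Theta) (y : Z -> R) : Prop :=
  if `[< a = f th /\ (forall z, u i th a <= u i th z) /\
         is_i_max_set i (LZ i (delta (f th)) th) >]
  then y = delta a
  else LY i (delta a) th y.

Definition LYhat_monotonic (f : Theta -> Z) : Prop :=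
  forall th th' : Theta,
    (forall i : 'I_n, forall y, LYhat f i (f th) th y -> LY i (delta (f th)) th' y) ->
    f th = f th'.

Section Mech.
Variables (M : 'I_n -> countType) (g : (forall i, M i) -> Z -> R).

Definition is_mixed_strategy (i : 'I_n) (p : M i -> R) : Prop :=
  (forall x, 0 <= p x) /\ (\esum_(x in [set: M i]) (p x)%:E = 1)%E.

Definition is_mixed_profile (lam : forall i, M i -> R) : Prop :=
  forall i, is_mixed_strategy (lam i).

Definition outcome (lam : forall i, M i -> R) : Z -> R :=
  fun z => fine (\esum_(m in [set: forall i, M i])
                   ((\prod_(i : 'I_n) lam i (m i)) * g m z)%:E).

Definition MNE (th : Theta) (lam : forall i, M i -> R) : Prop :=
  is_mixed_profile lam /\
  forall (i : 'I_n) (p : M i -> R), is_mixed_strategy p ->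
    U i th (outcome (@dfwith _ (fun j => M j -> R) lam i p)) <= U i th (outcome lam).

Definition PNE (th : Theta) (m : forall i, M i) : Prop :=
  forall (i : 'I_n) (x : M i),
    U i th (g (@dfwith _ (fun j => M j) m i x)) <= U i th (g m).

End Mech.

Definition is_mechanism (M : 'I_n -> countType) (g : (forall i, M i) -> Z -> R) : Prop :=
  forall m, is_lottery (g m).

Definition MNE_supp_eq (M : 'I_n -> countType) (g : (forall i, M i) -> Z -> R)
  (f : Theta -> Z) : Prop :=
  forall th z, (exists lam, MNE g th lam /\ 0 < outcome g lam z) <-> z = f th.

Definition PNE_supp_eq (M : 'I_n -> countType) (g : (forall i, M i) -> Z -> R)
  (f : Theta -> Z) : Prop :=
  forall th z, (exists m, PNE g th m /\ 0 < g m z) <-> z = f th.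

Definition mixed_Nash_implementable (f : Theta -> Z) : Prop :=
  exists (M : 'I_n -> countType) (g : (forall i, M i) -> Z -> R),
    is_mechanism g /\ MNE_supp_eq g f.

Definition pure_Nash_implementable (f : Theta -> Z) : Prop :=
  exists (M : 'I_n -> countType) (g : (forall i, M i) -> Z -> R),
    is_mechanism g /\ PNE_supp_eq g f.

Definition double_Nash_implementable (f : Theta -> Z) : Prop :=
  exists (M : 'I_n -> countType) (g : (forall i, M i) -> Z -> R),
    is_mechanism g /\ MNE_supp_eq g f /\ PNE_supp_eq g f.

End Impl.

(* Main.v *)
(* Necessity.  At an equilibrium for [th] the outcome is [f th], so all
   deviations of [i] lead into the lower contour set.  If that set is an
   [i]-max set at some [th''], all these deviations are equilibria at [th'']
   and hence induce the same degenerate lottery; thus deviations stay in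
   [LYhat], and [LYhat]-inclusion preserves the equilibrium.

   Sufficiency.  Players report a state, an integer and an outcome.  If all
   players but [j] report [(th, 0)], player [j] gets a lottery of [LYhat] close
   to her best one at her reported state, perturbed towards a relatively
   interior point; if no such [j] exists, the largest integer wins the right to
   choose, perturbed towards the uniform lottery.  Reporting the true state with
   an arbitrarily large integer attains, in the limit, the supremum of what a
   player can attain against every profile of the others at once.  So at each
   profile in the support of a mixed equilibrium every player already attains
   that supremum, and the interior perturbations turn this into indifference,
   which is excluded unless the outcome is [f] of the true state. *)
Require Import Defs.
From HB Require Import structures.
From mathcomp Require Import all_boot all_order all_algebra.
From mathcomp Require Import all_classical all_reals ereal esum.
From mathcomp Require Import ring lra.
Set Implicit Arguments. Unset Strict Implicit. Unset Printing Implicit Defensive.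
Import Order.TTheory GRing.Theory Num.Theory.
Local Open Scope classical_set_scope.
Local Open Scope ring_scope.

(** * Sums of nonnegative families *)

Lemma ge0_esumZl (R : realType) (T : choiceType) (D : set T) (c : R)
    (a : T -> \bar R) :
  0 <= c -> (forall t, (0 <= a t)%E) ->
  (\esum_(t in D) (c%:E * a t) = c%:E * \esum_(t in D) a t)%E.
Proof.
move=> c0 a0; rewrite /esum -ereal_supZl//; last first.
  by apply/set0P; exists (\sum_(x \in set0) a x)%E, set0 => //; exact: fsets_set0.
congr ereal_sup; apply/seteqP; split => [_ [A DA <-]|_ [_ [A DA <-] <-]].
  by exists (\sum_(x \in A) a x)%E; [exists A|rewrite ge0_mule_fsumr].
by exists A => //; rewrite ge0_mule_fsumr.
Qed.

Lemma esum_gt0 (R : realType) (T : choiceType) (D : set T) (a : T -> \bar R) :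
  (0 < \esum_(t in D) a t -> exists2 t, D t & 0 < a t)%E.
Proof.
move=> s0; apply: contrapT => H; move: s0; rewrite ltNge => /negP; apply.
apply: ge_ereal_sup => _ [A [_ AD] <-]; apply: fsume_le0 => t At.
by rewrite leNgt; apply/negP => at0; apply: H; exists t => //; exact: AD.
Qed.

(* Finitely many points carry all but an arbitrarily small part of the sum of
   [w a], and on finitely many points the lower bounds on [b k] are uniform in
   [k]: no domination of [b] is needed. *)
Lemma esum_weight_gap (R : realType) (T : choiceType) (w a : T -> R)
    (b : nat -> T -> R) (t0 : T) (d : R) :
  (forall t, 0 <= w t) -> \esum_(t in [set: T]) (w t)%:E = 1%:E ->
  (forall t, 0 <= a t) -> (forall k t, 0 <= b k t) ->
  \esum_(t in [set: T]) (w t * a t)%:E \is a fin_num ->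
  (forall k, \esum_(t in [set: T]) (w t * b k t)%:E <=
             \esum_(t in [set: T]) (w t * a t)%:E)%E ->
  (forall t e, 0 < e -> exists K, forall k, (K <= k)%N -> a t - e <= b k t) ->
  0 < d -> (exists K, forall k, (K <= k)%N -> a t0 + d <= b k t0) ->
  w t0 = 0.
Proof.
move=> w0 w1 a0 b0 afin ba conv d0 [K0 HK0].
apply/eqP/negPn/negP => wt0.
have wt0_gt : 0 < w t0 by rewrite lt_neqAle eq_sym wt0 w0.
(* The gain [4 * e] at [t0] has to outweigh two errors of at most [e] each: truncating the sum of
   [w a] to [A], and using the bound [a t - e] on [B], whose weight is at most 1. *)
pose e := w t0 * d / 4.
have e0 : 0 < e by rewrite /e divr_gt0// mulr_gt0.
have e4 : 4 * e = w t0 * d by rewrite /e; field.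
clearbody e.
have [_ [A [finA _] <-] hA] := ub_ereal_sup_adherent e0 afin.
pose B := A `|` [set t0].
have finB : finite_set B by rewrite finite_setU; split.
have BA : (\sum_(t \in A) (w t * a t)%:E <= \sum_(t \in B) (w t * a t)%:E)%E.
  apply: lee_fsum_nneg_subset => //.
    by move=> t; rewrite !inE; left.
  by move=> t _; rewrite lee_fin mulr_ge0.
have [K HK] : exists K, forall k, (K <= k)%N -> forall t, B t -> a t - e <= b k t.
  pose F := fset_set B.
  have cv t : exists K, forall k, (K <= k)%N -> a t - e <= b k t by exact: conv.
  pose N t := projT1 (cid (cv t)).
  exists (\max_(t <- finmap.enum_fset F) N t)%N => k Fk t Bt.
  apply: (projT2 (cid (cv t))).
  apply: leq_trans Fk.
  rewrite -/(N t).
  apply: leq_bigmax_seq => //.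
  by have := in_fset_set finB t; rewrite mem_set.
pose k := maxn K0 K.
have := ba k; apply/negP; rewrite -ltNge.
have hB : (\sum_(t \in B) (w t * b k t)%:E <= \esum_(t in [set: T]) (w t * b k t)%:E)%E.
  by apply: esum_ge; exists B.
apply: lt_le_trans hB.
have wB : \sum_(t \in B) w t <= 1.
  rewrite -lee_fin -fsumEFin// -w1.
  by apply: esum_ge; exists B.
rewrite fsbig_finite//= in wB.
set F := finmap.enum_fset (fset_set B) in wB.
have FB t : t \in F -> B t.
  by move=> tF; have := in_fset_set finB t; rewrite tF => /esym/set_mem.
have t0F : t0 \in F.
  by have := in_fset_set finB t0; rewrite (@mem_set _ B t0) => [->//|]; right.
have term t : B t -> 0 <= w t * (b k t - a t + e).
  move=> Bt; rewrite mulr_ge0//; have := HK k (leq_maxr _ _) t Bt; lra.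
have gap : 4 * e <= \sum_(t <- F) w t * (b k t - a t + e).
  rewrite (big_rem t0)//=.
  have := HK0 k (leq_maxl _ _) => h0.
  have : 0 <= \sum_(t <- seq.rem t0 F) w t * (b k t - a t + e).
    by rewrite big_seq sumr_ge0// => t /mem_rem /FB /term.
  have : w t0 * d <= w t0 * (b k t0 - a t0 + e) by rewrite ler_pM2l//; lra.
  by lra.
have key : \sum_(t \in B) (w t * a t) + 3 * e <= \sum_(t \in B) (w t * b k t).
  rewrite !fsbig_finite//= -/F.
  have E : \sum_(t <- F) w t * (b k t - a t + e) =
      \sum_(t <- F) w t * b k t - \sum_(t <- F) w t * a t + e * \sum_(t <- F) w t.
    rewrite mulr_sumr -sumrB -big_split/=; apply: eq_bigr => t _; ring.
  rewrite {}E in gap.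
  have : e * \sum_(t <- F) w t <= e by rewrite ler_piMr// ltW.
  lra.
have {}hA : (\esum_(t in [set: T]) (w t * a t)%:E - e%:E <
    \sum_(t \in A) (w t * a t)%:E)%E := hA.
rewrite !fsumEFin// in BA hA *.
rewrite -(fineK afin) -EFinB lte_fin in hA.
rewrite -(fineK afin) lte_fin.
rewrite lee_fin in BA.
lra.
Qed.

(** * Pure and mixed profiles *)

Lemma dfwith_id (I : eqType) (T : I -> Type) (m : forall i, T i) i :
  dfwith m i (m i) = m.
Proof. by apply: functional_extensionality_dep => j; case: dfwithP. Qed.

Lemma dfwith_dfwith (I : eqType) (T : I -> Type) (m : forall i, T i) i (x y : T i) :
  dfwith (dfwith m i x) i y = dfwith m i y.
Proof.
apply: functional_extensionality_dep => j.
by case: dfwithP => [|j' ij']; [rewrite dfwithin|rewrite !dfwithout].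
Qed.

Definition dirac_strategy (R : realType) (T : choiceType) (x y : T) : R :=
  if y == x then 1 else 0.

Section Profiles.
Variables (R : realType) (n : nat) (M : 'I_n -> countType).
Implicit Types (lam : forall i, M i -> R) (h : (forall i, M i) -> R).

Definition weight lam (m : forall i, M i) : R := \prod_(i < n) lam i (m i).

(** Spelled like the deviations in [PNE], as [dswitch] is like those in [MNE], so that these
    definitions apply by conversion. *)
Definition dwith (m : forall i, M i) i (x : M i) : forall i, M i :=
  @dfwith _ (fun j => M j) m i x.

Definition dswitch lam i (p : M i -> R) : forall i, M i -> R :=
  @dfwith _ (fun j => M j -> R) lam i p.

Lemma is_mixed_dirac i (x : M i) : is_mixed_strategy (dirac_strategy R x).
Proof.
split=> [y|]; first by rewrite /dirac_strategy; case: eqP.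
rewrite -(@esum_set1 R _ x (fun=> 1%E))// [RHS]esum_mkcond; apply: eq_esum => y _.
rewrite /dirac_strategy; case: eqP => [->|yx]; first by rewrite mem_set.
by rewrite memNset.
Qed.

Definition dirac_profile (m : forall i, M i) : forall i, M i -> R :=
  fun i => dirac_strategy R (m i).

Lemma is_mixed_dirac_profile m : is_mixed_profile (dirac_profile m).
Proof. by move=> i; exact: is_mixed_dirac. Qed.

Lemma weight_dirac_profile (m m' : forall i, M i) :
  weight (dirac_profile m) m' = (m' == m)%:R.
Proof.
rewrite /weight; case: eqP => [->|mm'].
  by rewrite big1// => i _; rewrite /dirac_profile /dirac_strategy eqxx.
have [i mi] : exists i, m' i != m i.
  apply: contrapT => H; apply: mm'; apply: functional_extensionality_dep => i.
  by apply/eqP/negPn/negP => mi; apply: H; exists i.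
by rewrite (bigD1 i)//= /dirac_profile /dirac_strategy (negbTE mi) mul0r.
Qed.

Lemma esum_dirac_profile (m : forall i, M i) h : (forall m, 0 <= h m) ->
  (\esum_(m' in [set: forall i, M i]) (weight (dirac_profile m) m' * h m')%:E =
   (h m)%:E)%E.
Proof.
move=> h0; rewrite -[RHS](@esum_set1 R _ m (fun m => (h m)%:E)) ?lee_fin//.
rewrite [RHS]esum_mkcond; apply: eq_esum => m' _.
rewrite weight_dirac_profile; case: eqP => [->|mm']; first by rewrite mem_set// mul1r.
by rewrite memNset// mul0r.
Qed.

Lemma is_mixed_switch lam i (p : M i -> R) :
  is_mixed_profile lam -> is_mixed_strategy p -> is_mixed_profile (dswitch lam p).
Proof. by move=> hl hp j; rewrite /dswitch; case: dfwithP. Qed.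

Lemma weight_ge0 lam m : is_mixed_profile lam -> 0 <= weight lam m.
Proof. by move=> hl; apply: prodr_ge0 => i _; exact: (hl i).1. Qed.

Lemma weight_switch lam i (p : M i -> R) (m : forall i, M i) :
  weight (dswitch lam p) m = p (m i) * \prod_(j < n | j != i) lam j (m j).
Proof.
rewrite /weight (bigD1 i)//= /dswitch dfwithin; congr (_ * _).
by apply: eq_bigr => j ji; rewrite dfwithout// eq_sym.
Qed.

Lemma weightD1 lam i (m : forall i, M i) :
  weight lam m = lam i (m i) * \prod_(j < n | j != i) lam j (m j).
Proof. by rewrite /weight (bigD1 i). Qed.

Lemma dwith_id (m : forall i, M i) i x : m i = x -> dwith m x = m.
Proof. by move=> <-; exact: dfwith_id. Qed.

Lemma dwith_dwith (m : forall i, M i) i (x y : M i) :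
  dwith (dwith m x) y = dwith m y.
Proof. exact: dfwith_dfwith. Qed.

Lemma dwith_in (m : forall i, M i) i (x : M i) : dwith m x i = x.
Proof. exact: dfwithin. Qed.

Lemma dwith_out (m : forall i, M i) i (x : M i) j : i != j -> dwith m x j = m j.
Proof. exact: dfwithout. Qed.

(* A profile is the same thing as an action of player [i] together with a
   profile in which [i] plays [x]; summing out the former coordinate gives 1. *)
Lemma esum_resample lam i (x : M i) h :
  is_mixed_profile lam -> (forall m, 0 <= h m) ->
  (\esum_(m in [set: forall i, M i]) (weight lam m * h (dwith m x))%:E =
   \esum_(m in [set: forall i, M i])
      (weight (dswitch lam (dirac_strategy R x)) m * h m)%:E)%E.
Proof.
move=> hl h0.
pose S := [set m : forall i, M i | m i = x].
pose r m : R := \prod_(j < n | j != i) lam j (m j).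
have r0 m : 0 <= r m by apply: prodr_ge0 => j _; exact: (hl j).1.
have rW m (y : M i) : r (dwith m y) = r m.
  by apply: eq_bigr => j ji; rewrite dwith_out// eq_sym.
(* Both sides equal the sum over the profiles in which [i] plays [x], weighted by the product [r] of
   the other players' probabilities. *)
transitivity (\esum_(m in S) (r m * h m)%:E)%E; last first.
  rewrite esum_mkcond; apply: eq_esum => m _.
  rewrite weight_switch /dirac_strategy; case: eqP => [mx|mx].
    by rewrite mem_set// mul1r.
  by rewrite memNset// !mul0r.
transitivity (\esum_(m in S) \esum_(y in [set: M i]) (r m * h m * lam i y)%:E)%E;
  last first.
  apply: eq_esum => m Sm.
  under eq_esum do rewrite EFinM.
  rewrite ge0_esumZl ?mulr_ge0//; last by move=> t; rewrite lee_fin (hl i).1.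
  by rewrite (hl i).2 mule1.
rewrite esum_esum; last first.
  by move=> m y _ _; rewrite lee_fin mulr_ge0 ?mulr_ge0// (hl i).1.
rewrite (@reindex_esum _ _ _ (S `*`` fun=> [set: M i]) setT (fun k => dwith k.1 k.2)).
  apply: eq_esum => -[m y] [/= Sm _].
  rewrite (weightD1 _ i) -/(r _) rW dwith_in dwith_dwith dwith_id//.
  by congr EFin; ring.
split => //.
- move=> [m y] [m' y']; rewrite !inE/= => -[Sm _] [Sm' _] E.
  have yy : y = y' by rewrite -(dwith_in m y) E dwith_in.
  by congr pair => //; rewrite -(dwith_id Sm) -(dwith_id Sm') -(dwith_dwith m y) E dwith_dwith.
- move=> m _; exists (dwith m x, m i) => /=.
    by split => //=; rewrite /S/= dwith_in.
  by rewrite dwith_dwith dwith_id.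
Qed.

(** The players are switched one at a time to pure strategies; by [esum_resample] with [h = 1] no
    switch changes the total, and a Dirac profile has total 1. *)
Lemma esum_weight lam : is_mixed_profile lam ->
  (\esum_(m in [set: forall i, M i]) (weight lam m)%:E = 1)%E.
Proof.
move=> hl.
(* No action set is empty, since its probabilities would sum to 0. *)
have [m0] : exists m0 : forall i, M i, True.
  suff H i : exists x : M i, True by exists (fun i => projT1 (cid (H i))).
  apply: contrapT => H; have := (hl i).2.
  rewrite esum1 => [[/eqP]|x]; first by rewrite eq_sym oner_eq0.
  by exfalso; apply: H; exists x.
move=> _; pose d := dirac_profile m0.
have step lam' i : is_mixed_profile lam' ->
    (\esum_(m in [set: forall i, M i]) (weight lam' m)%:E =
     \esum_(m in [set: forall i, M i]) (weight (dswitch lam' (d i)) m)%:E)%E.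
  move=> hl'; have := @esum_resample lam' i (m0 i) (fun=> 1) hl' (fun=> ler01).
  by under eq_esum do rewrite mulr1; under [in RHS]eq_esum do rewrite mulr1.
have [lam' [hl' -> Hd]] : exists lam', [/\ is_mixed_profile lam',
    (\esum_(m in [set: forall i, M i]) (weight lam m)%:E =
     \esum_(m in [set: forall i, M i]) (weight lam' m)%:E)%E &
    forall i, i \in enum 'I_n -> lam' i = d i].
  elim: (enum 'I_n) => [|i s [lam' [hl' -> Hd]]]; first by exists lam.
  exists (dswitch lam' (d i)); split; [|exact: step|].
    by apply: is_mixed_switch => //; exact: is_mixed_dirac.
  move=> j; rewrite inE /dswitch => /orP[/eqP ->|js]; first by rewrite dfwithin.
  by have := Hd j js; case: dfwithP => // k ik.
have -> : lam' = d.
  by apply: functional_extensionality_dep => i; rewrite Hd// mem_enum.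
have := @esum_dirac_profile m0 (fun=> 1) (fun=> ler01).
by under eq_esum do rewrite mulr1.
Qed.

End Profiles.

(** * Expected payoffs and mixed equilibria *)

Section Outcomes.
Variables (R : realType) (n : nat) (Theta : countType) (Z : finType).
Variable (u : 'I_n -> Theta -> Z -> R).
Implicit Types (y : Z -> R) (i : 'I_n) (th : Theta).

(** Added to utilities to make them nonnegative, so that expected payoffs can be handled by
    [esum]. *)
Definition ubound i th : R := \sum_(z : Z) `|u i th z|.

Lemma normr_le_ubound i th z : `|u i th z| <= ubound i th.
Proof. by rewrite /ubound (bigD1 z)//= lerDl sumr_ge0. Qed.

Lemma addr_ubound_ge0 i th z : 0 <= u i th z + ubound i th.
Proof.
have := normr_le_ubound i th z; have := ler_norm (- u i th z); rewrite normrN; lra.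
Qed.

Lemma lottery_le1 y z : is_lottery y -> y z <= 1.
Proof. by move=> [y0 <-]; rewrite (bigD1 z)//= lerDl sumr_ge0. Qed.

Lemma U_addr_ubound y i th : is_lottery y ->
  U u i th y + ubound i th = \sum_z y z * (u i th z + ubound i th).
Proof.
move=> [_ y1]; rewrite /U -[X in _ + X]mul1r -y1 mulr_suml -big_split/=.
by apply: eq_bigr => z _; rewrite mulrDr.
Qed.

Lemma U_addr_ubound_ge0 y i th : is_lottery y -> 0 <= U u i th y + ubound i th.
Proof.
move=> hy; rewrite U_addr_ubound// sumr_ge0// => z _.
by rewrite mulr_ge0 ?addr_ubound_ge0// hy.1.
Qed.

Variables (M : 'I_n -> countType) (g : (forall i, M i) -> Z -> R).
Hypothesis hg : is_mechanism g.
Implicit Types (lam : forall i, M i -> R) (m : forall i, M i).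

(** The [fine] in [outcome] is harmless: the sum is dominated by the total weight 1. *)
Lemma outcomeE lam z : is_mixed_profile lam ->
  (outcome g lam z)%:E =
  \esum_(m in [set: forall i, M i]) (weight lam m * g m z)%:E.
Proof.
move=> hl; rewrite /outcome fineK// ge0_fin_numE; last first.
  by apply: esum_ge0 => m _; rewrite lee_fin mulr_ge0 ?(weight_ge0 _ hl)// (hg m).1.
apply: (@le_lt_trans _ _ 1%E); last exact: ltry.
rewrite -(esum_weight hl); apply: le_esum => m _.
by rewrite lee_fin ler_piMr ?(weight_ge0 _ hl)// lottery_le1.
Qed.

Lemma outcome_sum lam (v : Z -> R) : is_mixed_profile lam -> (forall z, 0 <= v z) ->
  (\sum_z outcome g lam z * v z)%:E =
  \esum_(m in [set: forall i, M i]) (weight lam m * \sum_z g m z * v z)%:E.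
Proof.
move=> hl v0.
have t0 m z : (0 <= (weight lam m * g m z)%:E)%E.
  by rewrite lee_fin mulr_ge0 ?(weight_ge0 _ hl)// (hg m).1.
transitivity (\sum_z \esum_(m in [set: forall i, M i])
    ((v z)%:E * (weight lam m * g m z)%:E))%E.
  rewrite -sumEFin; apply: eq_bigr => z _.
  by rewrite ge0_esumZl// -outcomeE// -EFinM mulrC.
rewrite -esum_sum; last by move=> m z _ _; rewrite mule_ge0// lee_fin.
apply: eq_esum => m _; rewrite mulr_sumr -sumEFin; apply: eq_bigr => z _.
by rewrite -EFinM; congr EFin; ring.
Qed.

Lemma outcome_lottery lam : is_mixed_profile lam -> is_lottery (outcome g lam).
Proof.
move=> hl; split=> [z|].
  rewrite -lee_fin outcomeE//; apply: esum_ge0 => m _.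
  by rewrite lee_fin mulr_ge0 ?(weight_ge0 _ hl)// (hg m).1.
apply: EFin_inj; have := @outcome_sum lam (fun=> 1) hl (fun=> ler01).
under eq_bigr do rewrite mulr1; move=> ->; rewrite -[RHS](esum_weight hl).
apply: eq_esum => m _; under eq_bigr do rewrite mulr1.
by rewrite (hg m).2 mulr1.
Qed.

Lemma U_outcome lam i th : is_mixed_profile lam ->
  (U u i th (outcome g lam) + ubound i th)%:E =
  \esum_(m in [set: forall i, M i])
    (weight lam m * (U u i th (g m) + ubound i th))%:E.
Proof.
move=> hl; rewrite U_addr_ubound; last exact: outcome_lottery.
rewrite outcome_sum//; last by move=> z; exact: addr_ubound_ge0.
by apply: eq_esum => m _; rewrite U_addr_ubound.
Qed.

Lemma U_outcome_le lam i th c : is_mixed_profile lam ->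
  (forall m, 0 < weight lam m -> U u i th (g m) <= c) ->
  U u i th (outcome g lam) <= c.
Proof.
move=> hl hc.
(* A profile of positive weight yields [0 <= c + ubound u i th], which allows this constant to be
   moved into the sum. *)
have [m _] : exists2 m, [set: forall i, M i] m & (0 < (weight lam m)%:E)%E.
  by apply: esum_gt0; rewrite esum_weight.
rewrite lte_fin => /hc Um.
have cB : 0 <= c + ubound i th.
  by have := @U_addr_ubound_ge0 _ i th (hg m); lra.
rewrite -(lerD2r (ubound i th)) -lee_fin U_outcome//.
rewrite -[leRHS]mule1 -(esum_weight hl) -ge0_esumZl//; last first.
  by move=> m'; rewrite lee_fin weight_ge0.
apply: le_esum => m' _; rewrite -EFinM lee_fin [leRHS]mulrC.
have := weight_ge0 m' hl; rewrite le_eqVlt => /predU1P[<-|w0].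
  by rewrite !mul0r.
by rewrite ler_pM2l// lerD2r hc.
Qed.

(** Keeping the original weights lets a pure deviation be compared with [lam] profile by profile. *)
Lemma U_outcome_dirac_switch lam i j th (x : M j) : is_mixed_profile lam ->
  (U u i th (outcome g (dswitch lam (dirac_strategy R x))) + ubound i th)%:E =
  \esum_(m in [set: forall i, M i])
    (weight lam m * (U u i th (g (dwith m x)) + ubound i th))%:E.
Proof.
move=> hl; rewrite U_outcome; last first.
  by apply: is_mixed_switch => //; exact: is_mixed_dirac.
rewrite -(@esum_resample _ _ _ lam j x (fun m => U u i th (g m) + ubound i th))//.
by move=> m; exact: U_addr_ubound_ge0.
Qed.

(** In the limit, deviating to [x k] loses nothing at any profile, so a gain of [d] at a profile of
    positive weight would make some [x k] profitable. *)
Lemma MNE_no_gain lam i th (x : nat -> M i) m0 d : MNE u g th lam ->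
  (forall m e, 0 < e -> exists K, forall k, (K <= k)%N ->
     U u i th (g m) - e <= U u i th (g (dwith m (x k)))) ->
  0 < d ->
  (exists K, forall k, (K <= k)%N ->
     U u i th (g m0) + d <= U u i th (g (dwith m0 (x k)))) ->
  weight lam m0 = 0.
Proof.
move=> [hl eqm] conv d0 [K0 HK0].
apply: (@esum_weight_gap _ _ _ (fun m => U u i th (g m) + ubound i th)
  (fun k m => U u i th (g (dwith m (x k))) + ubound i th) m0 d) => //.
- by move=> m; exact: weight_ge0.
- exact: esum_weight.
- by move=> m; exact: U_addr_ubound_ge0.
- by move=> k m; exact: U_addr_ubound_ge0.
- by rewrite -U_outcome.
- move=> k; rewrite -U_outcome// -U_outcome_dirac_switch// lee_fin lerD2r.
  exact/eqm/is_mixed_dirac.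
- move=> m e e0; have [K HK] := conv m e e0; exists K => k Kk.
  by have := HK k Kk; lra.
- by exists K0 => k Kk; have := HK0 k Kk; lra.
Qed.

Lemma outcome_dirac_profile m : outcome g (dirac_profile R m) = g m.
Proof.
apply/funext => z; apply: EFin_inj; rewrite outcomeE; last exact: is_mixed_dirac_profile.
by rewrite (@esum_dirac_profile _ _ _ _ (g^~ z))// => m'; exact: (hg m').1.
Qed.

(** After a mixed deviation of [i] from a Dirac profile, all profiles of positive weight are pure
    deviations of [i] from [m]. *)
Lemma PNE_MNE th m : PNE u g th m -> MNE u g th (dirac_profile R m).
Proof.
move=> Hm; split=> [|i p hp]; first exact: is_mixed_dirac_profile.
rewrite outcome_dirac_profile; apply: U_outcome_le => [|m'].
  by apply: is_mixed_switch => //; exact: is_mixed_dirac_profile.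
rewrite weight_switch => w0; suff -> : m' = dwith m (m' i) by exact: Hm.
apply: functional_extensionality_dep => j.
case: (eqVneq j i) => [->|ji]; first by rewrite dwith_in.
rewrite dwith_out 1?eq_sym//; apply/eqP/negPn/negP => mj; move: w0.
by rewrite (bigD1 j)//= /dirac_profile /dirac_strategy (negbTE mj) mul0r mulr0 ltxx.
Qed.

Lemma outcome_gt0 lam z : is_mixed_profile lam -> 0 < outcome g lam z ->
  exists m, 0 < weight lam m /\ 0 < g m z.
Proof.
move=> hl; rewrite -lte_fin outcomeE// => /esum_gt0[m _]; rewrite lte_fin => wg.
exists m; have := weight_ge0 m hl; have := (hg m).1 z.
rewrite !le_eqVlt => /predU1P[gz|gz]; first by rewrite -gz mulr0 ltxx in wg.
by case/predU1P => [wz|//]; rewrite -wz mul0r ltxx in wg.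
Qed.

End Outcomes.

(** * Lotteries over a finite set *)

Section Lotteries.
Variables (R : realType) (Z : finType).
Implicit Types (y : Z -> R) (v : Z -> R).

Lemma lottery_support_le y v c : is_lottery y ->
  (forall z, 0 < y z -> v z <= c) -> \sum_z y z * v z <= c.
Proof.
move=> [y0 y1] vc; rewrite -[leRHS]mul1r -y1 mulr_suml; apply: ler_sum => z _.
have := y0 z; rewrite le_eqVlt => /predU1P[<-|yz]; first by rewrite !mul0r.
by rewrite ler_pM2l// vc.
Qed.

Lemma lottery_support_ge y v c : is_lottery y ->
  (forall z, 0 < y z -> c <= v z) -> c <= \sum_z y z * v z.
Proof.
move=> hy vc; rewrite -lerN2 -sumrN; under eq_bigr do rewrite -mulrN.
by apply: lottery_support_le => // z /vc; rewrite lerN2.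
Qed.

Lemma lottery_support_const y v c : is_lottery y ->
  (forall z, 0 < y z -> v z = c) -> \sum_z y z * v z = c.
Proof.
move=> hy vc; apply/eqP; rewrite eq_le lottery_support_le ?lottery_support_ge//.
- by move=> z /vc ->.
- by move=> z /vc ->.
Qed.

(** The terms [y z' * (c - v z')] are nonnegative and sum to at most 0, so all vanish. This turns
    optimality of a lottery into indifference on its support. *)
Lemma lottery_support_max y v c : is_lottery y ->
  (forall z, 0 < y z -> v z <= c) -> c <= \sum_z y z * v z ->
  forall z, 0 < y z -> v z = c.
Proof.
move=> [y0 y1] vc cv z yz.
have t0 z' : 0 <= y z' * (c - v z').
  have := y0 z'; rewrite le_eqVlt => /predU1P[<-|yz']; first by rewrite mul0r.
  by rewrite mulr_ge0// subr_ge0 vc.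
have /eqP : \sum_z' y z' * (c - v z') = 0.
  apply/eqP; rewrite eq_le sumr_ge0// andbT.
  under eq_bigr do rewrite mulrBr.
  by rewrite sumrB -mulr_suml y1 mul1r subr_le0.
rewrite psumr_eq0// => /allP/(_ z); rewrite mem_index_enum => /(_ isT)/=.
by rewrite mulf_eq0 gt_eqF//= subr_eq0 => /eqP.
Qed.

Lemma lottery_support_min y v c : is_lottery y ->
  (forall z, 0 < y z -> c <= v z) -> \sum_z y z * v z <= c ->
  forall z, 0 < y z -> v z = c.
Proof.
move=> hy vc cv z yz; apply: oppr_inj.
apply: (@lottery_support_max y (fun z => - v z) (- c) hy) => //.
  by move=> z' /vc; rewrite lerN2.
by under eq_bigr do rewrite mulrN; rewrite sumrN lerN2.
Qed.

Lemma lottery_delta (a : Z) : is_lottery (delta R a).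
Proof.
split=> [z|]; first by rewrite /delta; case: eqP.
rewrite (bigD1 a)//= /delta eqxx big1 ?addr0// => z /negbTE -> //.
Qed.

Lemma delta_gt0 (a z : Z) : 0 < delta R a z -> z = a.
Proof. by rewrite /delta; case: eqP => //; rewrite ltxx. Qed.

Lemma delta_self_gt0 (a : Z) : 0 < delta R a a.
Proof. by rewrite /delta eqxx. Qed.

Lemma lottery_eq_delta y a : is_lottery y -> (forall z, 0 < y z -> z = a) ->
  y = delta R a.
Proof.
move=> [y0 y1] ya.
have y_0 z : z != a -> y z = 0.
  move=> za; apply/eqP; rewrite eq_le y0 andbT leNgt; apply/negP => /ya zE.
  by rewrite zE eqxx in za.
apply/funext => z; rewrite /delta; case: eqP => [->|/eqP/y_0//].
by rewrite -y1 (bigD1 a)//= big1 ?addr0.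
Qed.

Definition mix (t : R) y1 y2 : Z -> R := fun z => (1 - t) * y1 z + t * y2 z.

Lemma lottery_mix t y1 y2 : 0 <= t <= 1 -> is_lottery y1 -> is_lottery y2 ->
  is_lottery (mix t y1 y2).
Proof.
move=> /andP[t0 t1] [p1 s1] [p2 s2]; split=> [z|].
  by rewrite /mix addr_ge0// mulr_ge0// subr_ge0.
by rewrite big_split/= -!mulr_sumr s1 s2; ring.
Qed.

Definition unif (E : {set Z}) : Z -> R :=
  fun z => if z \in E then #|E|%:R^-1 else 0.

Lemma lottery_unif (E : {set Z}) a : a \in E -> is_lottery (unif E).
Proof.
move=> aE; split=> [z|]; first by rewrite /unif; case: ifP => // _; rewrite invr_ge0.
rewrite -big_mkcond/= sumr_const -[_ *+ _]mulr_natl mulfV// pnatr_eq0 -lt0n.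
by rewrite card_gt0; apply/set0Pn; exists a.
Qed.

Lemma unif_gt0 (E : {set Z}) z : (0 < unif E z) = (z \in E).
Proof.
rewrite /unif; case: ifP => [zE|]; last by rewrite ltxx.
by rewrite invr_gt0 ltr0n card_gt0; apply/set0Pn; exists z.
Qed.

End Lotteries.

(** * Lower contour sets *)

Section Payoffs.
Variables (R : realType) (n : nat) (Theta : countType) (Z : finType).
Variable (u : 'I_n -> Theta -> Z -> R).

Lemma U_delta i th a : U u i th (delta R a) = u i th a.
Proof.
by apply: lottery_support_const => [|z /delta_gt0 -> //]; exact: lottery_delta.
Qed.

Lemma U_mix i th t y1 y2 :
  U u i th (mix t y1 y2) = (1 - t) * U u i th y1 + t * U u i th y2.
Proof.
by rewrite /U !mulr_sumr -big_split/=; apply: eq_bigr => z _; rewrite /mix; ring.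
Qed.

Lemma in_LZ i a th z : (z \in LZ u i (delta R a) th) = (u i th z <= u i th a).
Proof. by rewrite inE U_delta. Qed.

Lemma LY_self i th a : LY u i (delta R a) th (delta R a).
Proof. by split=> //; exact: lottery_delta. Qed.

(** An average that does not exceed the minimum [u i th a] charges only minimizers. *)
Lemma LY_argmin_support i th a y z : (forall z, u i th a <= u i th z) ->
  LY u i (delta R a) th y -> 0 < y z -> z \in LZ u i (delta R a) th.
Proof.
move=> amin [hy]; rewrite U_delta => Uy yz; rewrite in_LZ.
by rewrite (@lottery_support_min _ _ y (u i th) _ hy _ Uy z yz).
Qed.

Variable f : Theta -> Z.

(** The condition under which [LYhat] at [f th] collapses to a point. *)
Definition degenerate i th : Prop :=
  (forall z, u i th (f th) <= u i th z) /\
  is_i_max_set u i (LZ u i (delta R (f th)) th).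

Lemma LYhat_degenerate i th y : degenerate i th ->
  LYhat u f i (f th) th y <-> y = delta R (f th).
Proof. by move=> [? ?]; rewrite /LYhat; case: asboolP => // H; exfalso; exact: H. Qed.

Lemma LYhat_regular i th y : ~ degenerate i th ->
  LYhat u f i (f th) th y <-> LY u i (delta R (f th)) th y.
Proof. by move=> nd; rewrite /LYhat; case: asboolP => // -[_ H]; exfalso; exact: nd. Qed.

Lemma LYhat_sub i th y : LYhat u f i (f th) th y -> LY u i (delta R (f th)) th y.
Proof.
have [d|d] := pselect (degenerate i th).
  by move=> /(LYhat_degenerate _ d) ->; exact: LY_self.
by move=> /(LYhat_regular _ d).
Qed.

Lemma LYhat_self i th : LYhat u f i (f th) th (delta R (f th)).
Proof.
have [d|d] := pselect (degenerate i th); first exact/LYhat_degenerate.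
by apply/LYhat_regular => //; exact: LY_self.
Qed.

End Payoffs.

(** * Necessity of monotonicity *)

(* Pure and mixed strategies at once: [P] singles out the admissible strategies
   of each player and [o] maps admissible profiles to lotteries. *)
Section Necessity.
Variables (R : realType) (n : nat) (Theta : countType) (Z : finType).
Variables (u : 'I_n -> Theta -> Z -> R) (f : Theta -> Z).
Variables (S : 'I_n -> Type) (P : forall i, S i -> Prop).
Variable (o : (forall i, S i) -> Z -> R).
Hypothesis ho : forall s, (forall i, P (s i)) -> is_lottery (o s).

Definition equilibrium th (s : forall i, S i) : Prop :=
  (forall i, P (s i)) /\
  forall i (x : S i), P x -> U u i th (o (dfwith s i x)) <= U u i th (o s).

Hypothesis hf : forall th z, (exists s, equilibrium th s /\ 0 < o s z) <-> z = f th.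

Lemma equilibrium_outcome th s : equilibrium th s -> o s = delta R (f th).
Proof.
move=> eqs; apply: lottery_eq_delta => [|z oz]; first exact: ho eqs.1.
by apply/hf; exists s.
Qed.

Lemma P_dfwith (s : forall i, S i) i (x : S i) :
  (forall i, P (s i)) -> P x -> forall j, P (dfwith s i x j).
Proof. by move=> Ps Px j; case: dfwithP. Qed.

(* When the deviations of [i] all lead into a set that is [i]-maximal at [th''],
   they are themselves equilibria at [th'']. *)
Lemma deviation_LYhat th s i (x : S i) : equilibrium th s -> P x ->
  LYhat u f i (f th) th (o (dfwith s i x)).
Proof.
move=> eqs Px; have os := equilibrium_outcome eqs.
have dev (x' : S i) : P x' -> LY u i (delta R (f th)) th (o (dfwith s i x')).
  by move=> Px'; split; [exact/ho/P_dfwith/Px'/eqs.1 | rewrite -os; exact: eqs.2].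
have [d|d] := pselect (degenerate u f i th); last exact/(LYhat_regular _ d)/dev.
apply/(LYhat_degenerate _ d); have [fmin [th'' [_ [Ei Ej]]]] := d.
have supp x' z : P x' -> 0 < o (dfwith s i x') z ->
    z \in LZ u i (delta R (f th)) th.
  by move=> /dev; exact: LY_argmin_support.
have eq'' x' : P x' -> equilibrium th'' (dfwith s i x').
  move=> Px'; split=> [|j y Py]; first exact: P_dfwith eqs.1 Px'.
  have L : is_lottery (o (dfwith s i x')) by exact/ho/P_dfwith/Px'/eqs.1.
  (* A further deviation of [i] is again a deviation from [s], so it stays in a set on which [i] is
     indifferent at [th'']. For the other players this set consists of global maximizers. *)
  case: (eqVneq i j) y Py => [<-|ij] y Py.
    rewrite dfwith_dfwith.
    apply: lottery_support_le => [|z oz]; first exact/ho/P_dfwith/Py/eqs.1.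
    by apply: lottery_support_ge => // z' oz'; apply: Ei; [apply: supp oz'|apply: supp oz].
  apply: lottery_support_le => [|z _]; first exact/ho/P_dfwith/Py/P_dfwith/Px'/eqs.1.
  apply: lottery_support_ge => // z' oz'; apply: Ej; first by rewrite eq_sym.
  exact: supp oz'.
(* The choice [x' = s i] makes [s] itself an equilibrium at [th''], so that [f th''] and [f th]
   induce the same lottery. *)
have := equilibrium_outcome (eq'' _ (eqs.1 i)); rewrite dfwith_id os => E.
by rewrite (equilibrium_outcome (eq'' _ Px)) E.
Qed.

Lemma implementable_LYhat_monotonic : LYhat_monotonic u f.
Proof.
move=> th th' H; have [s [eqs os0]] := (hf th (f th)).2 erefl.
apply/hf; exists s; split=> //; split=> [|i x Px]; first exact: eqs.1.
by rewrite (equilibrium_outcome eqs); exact: (H i _ (deviation_LYhat eqs Px)).2.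
Qed.

End Necessity.

Lemma pure_LYhat_monotonic (R : realType) (n : nat) (Theta : countType) (Z : finType)
    (u : 'I_n -> Theta -> Z -> R) (f : Theta -> Z) :
  pure_Nash_implementable u f -> LYhat_monotonic u f.
Proof.
move=> [M [g [hg H]]].
apply: (@implementable_LYhat_monotonic _ _ _ _ u f M (fun _ _ => True) g) => // th z.
rewrite -H; split=> -[m [eqm gz]]; exists m; split=> //.
  by move=> i x; apply: eqm.2.
Qed.

Lemma mixed_LYhat_monotonic (R : realType) (n : nat) (Theta : countType) (Z : finType)
    (u : 'I_n -> Theta -> Z -> R) (f : Theta -> Z) :
  mixed_Nash_implementable u f -> LYhat_monotonic u f.
Proof.
move=> [M [g [hg H]]].
apply: (@implementable_LYhat_monotonic _ _ _ _ u f (fun i => M i -> R)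
  (fun i p => is_mixed_strategy p) (outcome g)) => [lam|th z].
  exact: outcome_lottery.
exact: H.
Qed.

(** * The implementing mechanism *)

Section Mechanism.
Variables (R : realType) (n : nat) (Theta : countType) (Z : finType).
Variables (u : 'I_n -> Theta -> Z -> R) (f : Theta -> Z).
Implicit Types (i j : 'I_n) (th ts : Theta) (y : Z -> R) (k : nat).

(** Serves both as perturbation weight and as tolerance. At [k = 0] it is 1, so the mixture is then
    the perturbing lottery alone. *)
Definition vanish k : R := k.+1%:R^-1.

Lemma vanish_gt0 k : 0 < vanish k. Proof. by rewrite invr_gt0 ltr0n. Qed.

Lemma vanish_itv k : 0 <= vanish k <= 1.
Proof. by rewrite ltW ?vanish_gt0//= invf_le1 ?ltr0n// ler1n. Qed.

Lemma vanish_small (c e : R) : 0 <= c -> 0 < e ->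
  exists K, forall k, (K <= k)%N -> vanish k * c <= e.
Proof.
move=> c0 e0; exists (Num.bound (c / e)) => k Kk.
rewrite mulrC ler_pdivrMr ?ltr0n// mulrC -ler_pdivrMr//.
have /ltW/le_trans := archi_boundP (divr_ge0 c0 (ltW e0)); apply.
by rewrite ler_nat leqW.
Qed.

Lemma U_le_ubound i th y : is_lottery y -> `|U u i th y| <= ubound u i th.
Proof.
move=> hy; rewrite ler_norml; apply/andP; split.
  apply: lottery_support_ge => // z _.
  by have := normr_le_ubound u i th z; rewrite ler_norml => /andP[].
apply: lottery_support_le => // z _.
by have := normr_le_ubound u i th z; rewrite ler_norml => /andP[].
Qed.

Lemma U_mix_vanish i th k y1 y2 : is_lottery y1 -> is_lottery y2 ->
  U u i th y1 - vanish k * (2 * ubound u i th) <= U u i th (mix (vanish k) y1 y2).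
Proof.
move=> h1 h2; rewrite U_mix.
have := U_le_ubound i th h1; have := U_le_ubound i th h2.
rewrite !ler_norml => /andP[l2 _] /andP[_ l1].
have := vanish_gt0 k; nra.
Qed.

Lemma mix_gt0 k y1 y2 z : is_lottery y1 -> 0 < y2 z -> 0 < mix (vanish k) y1 y2 z.
Proof.
move=> [y10 _] y2z; rewrite /mix ltr_wpDl//; last by rewrite mulr_gt0// vanish_gt0.
by rewrite mulr_ge0// subr_ge0; have /andP[] := vanish_itv k.
Qed.

Lemma LYhat_lottery i th y : LYhat u f i (f th) th y -> is_lottery y.
Proof. by case/LYhat_sub. Qed.

Lemma LYhat_mix i th t y1 y2 : 0 <= t <= 1 ->
  LYhat u f i (f th) th y1 -> LYhat u f i (f th) th y2 ->
  LYhat u f i (f th) th (mix t y1 y2).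
Proof.
move=> t01; have [d|d] := pselect (degenerate u f i th).
  move=> /(LYhat_degenerate _ d) -> /(LYhat_degenerate _ d) ->.
  by apply/(LYhat_degenerate _ d)/funext => z; rewrite /mix; ring.
move=> /(LYhat_regular _ d)[l1 U1] /(LYhat_regular _ d)[l2 U2].
apply/(LYhat_regular _ d); split; first exact: lottery_mix.
by rewrite U_mix; move/andP: t01 => [? ?]; nra.
Qed.

(** Approximate maximizers suffice, and they exist because utilities are bounded; no compactness
    argument is made. *)
Lemma exists_near_best i th ts k : exists y, LYhat u f i (f th) th y /\
  forall y', LYhat u f i (f th) th y' -> U u i ts y' - vanish k <= U u i ts y.
Proof.
pose E := [set U u i ts y | y in LYhat u f i (f th) th].
have supE : has_sup E.
  split; first by exists (U u i ts (delta R (f th))), (delta R (f th)) => //; exact: LYhat_self.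
  exists (ubound u i ts) => _ [y /LYhat_lottery hy <-].
  by have := U_le_ubound i ts hy; rewrite ler_norml => /andP[].
have [_ [y hy <-] supy] := sup_adherent (vanish_gt0 k) supE.
exists y; split=> // y' hy'; apply: le_trans (ltW supy); rewrite lerD2r.
by apply: sup_ubound; [exact: supE.2|exists y'].
Qed.

(** A relatively interior point of [LYhat]. In the degenerate case the set is a point; if [f th] is
    worst for [i], it is the face spanned by [LZ], and the barycentre is taken; otherwise a strictly
    worse outcome is moved slightly towards the uniform lottery. *)
Lemma exists_interior i th : exists y, [/\ LYhat u f i (f th) th y,
  ~ degenerate u f i th -> (forall z, u i th (f th) <= u i th z) ->
    forall z, z \in LZ u i (delta R (f th)) th -> 0 < y z &
  ~ (forall z, u i th (f th) <= u i th z) ->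
    (forall z, 0 < y z) /\ U u i th y < u i th (f th)].
Proof.
have [d|d] := pselect (degenerate u f i th).
  exists (delta R (f th)); split; [exact: LYhat_self|by []|].
  by move=> H; exfalso; exact: H d.1.
have [fmin|nfmin] := pselect (forall z, u i th (f th) <= u i th z).
  have fLZ : f th \in LZ u i (delta R (f th)) th by rewrite in_LZ.
  exists (unif R (LZ u i (delta R (f th)) th)); split => //.
  - apply/(LYhat_regular _ d); split; first exact: lottery_unif fLZ.
    rewrite U_delta; apply: lottery_support_le; first exact: lottery_unif fLZ.
    by move=> z; rewrite unif_gt0 in_LZ.
  - by move=> _ _ z zE; rewrite unif_gt0.
have [z1 uz1] : exists z1, u i th z1 < u i th (f th).
  by move/existsNP: nfmin => [z1 /negP]; rewrite -ltNge; exists z1.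
pose c := u i th (f th) - u i th z1.
have c0 : 0 < c / 2 by rewrite divr_gt0// subr_gt0.
have lunif : is_lottery (unif R [set: Z]%SET).
  by apply: (@lottery_unif _ _ _ z1); rewrite inE.
have ldelta := lottery_delta R z1.
have B0 : 0 <= 2 * ubound u i th by rewrite mulr_ge0// sumr_ge0.
(* Mixing shifts utility by at most [vanish K * (2 * ubound u i th)], hence by at most half of the
   gap [c]. *)
have [K /(_ K (leqnn _)) HK] := vanish_small B0 c0.
have hU : U u i th (mix (vanish K) (delta R z1) (unif R [set: Z]%SET)) < u i th (f th).
  rewrite U_mix U_delta.
  have := U_le_ubound i th lunif; have := U_le_ubound i th ldelta.
  rewrite U_delta !ler_norml => /andP[l1 _] /andP[_ l2].
  by have := vanish_gt0 K; rewrite /c in HK c0; nra.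
have hm : is_lottery (mix (vanish K) (delta R z1) (unif R [set: Z]%SET)).
  by apply: lottery_mix => //; exact: vanish_itv.
exists (mix (vanish K) (delta R z1) (unif R [set: Z]%SET)); split.
- by apply/(LYhat_regular _ d); split=> //; rewrite U_delta ltW.
- by [].
- by move=> _; split=> // z; apply: mix_gt0 => //; rewrite unif_gt0 inE.
Qed.

Definition near_best i th ts k : Z -> R := projT1 (cid (exists_near_best i th ts k)).
Definition interior_lottery i th : Z -> R := projT1 (cid (exists_interior i th)).

Lemma near_bestP i th ts k : LYhat u f i (f th) th (near_best i th ts k) /\
  forall y', LYhat u f i (f th) th y' ->
    U u i ts y' - vanish k <= U u i ts (near_best i th ts k).
Proof. exact: projT2 (cid (exists_near_best i th ts k)). Qed.

Lemma interiorP i th : [/\ LYhat u f i (f th) th (interior_lottery i th),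
  ~ degenerate u f i th -> (forall z, u i th (f th) <= u i th z) ->
    forall z, z \in LZ u i (delta R (f th)) th -> 0 < interior_lottery i th z &
  ~ (forall z, u i th (f th) <= u i th z) ->
    (forall z, 0 < interior_lottery i th z) /\ U u i th (interior_lottery i th) < u i th (f th)].
Proof. exact: projT2 (cid (exists_interior i th)). Qed.

(* A message [(th, k, z)]: a reported state, an integer that is [0] unless the
   player objects, and the outcome wanted in case of general disagreement. *)
Definition message : countType := (Theta * nat * Z)%type.
Implicit Types m : 'I_n -> message.

Definition others_agree m i th : bool :=
  [forall j, (j != i) ==> ((m j).1 == (th, 0%N))].

Definition unilateral i th (x : message) : Z -> R :=
  if x.1 == (th, 0%N) then delta R (f th)
  else mix (vanish x.1.2) (near_best i th x.1.1 x.1.2) (interior_lottery i th).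

Hypothesis hn : (3 <= n)%N.

Definition player0 : 'I_n := Ordinal (leq_trans (isT : (0 < 3)%N) hn).

Definition winner m : 'I_n := [arg max_(i > player0) (m i).1.2].

Definition disagreement m : Z -> R :=
  mix (vanish (m (winner m)).1.2) (delta R (m (winner m)).2) (unif R [set: Z]%SET).

(** The pair is picked by choice; [mechanism_unilateral] shows that the outcome does not depend on
    the pick. *)
Definition mechanism m : Z -> R :=
  if pselect (exists p : 'I_n * Theta, others_agree m p.1 p.2) is left H
  then unilateral (projT1 (cid H)).1 (projT1 (cid H)).2 (m (projT1 (cid H)).1)
  else disagreement m.

Lemma exists_third i j : exists l, l != i /\ l != j.
Proof.
apply: contrapT => none; suff : (#|'I_n| <= 2)%N by rewrite card_ord leqNgt hn.
apply: leq_trans (card_size [:: i; j]); apply: subset_leq_card.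
apply/fintype.subsetP => l _; rewrite !inE; apply: contrapT => /negP.
by rewrite negb_or => /andP[li lj]; apply: none; exists l.
Qed.

Lemma others_agreeE m i th j : others_agree m i th -> j != i -> (m j).1 = (th, 0%N).
Proof. by move=> /forallP/(_ j)/implyP H /H /eqP. Qed.

(** A third player forces two admissible pairs to share their state. If their players differ, each
    conforms by the other's pair, and both pairs give [f th]. *)
Lemma mechanism_unilateral m i th : others_agree m i th ->
  mechanism m = unilateral i th (m i).
Proof.
move=> mi; rewrite /mechanism; case: pselect => [H|]; last by case; exists (i, th).
case: (cid H) => -[i' th'] /= mi'.
have [l [li li']] := exists_third i i'.
have [E] : (th, 0%N) = (th', 0%N) by rewrite -(others_agreeE mi li) -(others_agreeE mi' li').
move: mi'; rewrite -{}E => mi'.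
have [->//|ii'] := eqVneq i i'.
by rewrite /unilateral (others_agreeE mi' ii') (others_agreeE mi (j := i')) 1?eq_sym// eqxx.
Qed.

Lemma mechanism_disagreement m : (forall i th, ~~ others_agree m i th) ->
  mechanism m = disagreement m.
Proof.
move=> H; rewrite /mechanism; case: pselect => // -[[i th]/= mi].
by exfalso; move: mi; apply/negP.
Qed.

Lemma unilateral_LYhat i th x : LYhat u f i (f th) th (unilateral i th x).
Proof.
rewrite /unilateral; case: ifP => _; first exact: LYhat_self.
apply: LYhat_mix; first exact: vanish_itv.
  by case: (near_bestP i th x.1.1 x.1.2).
by case: (interiorP i th).
Qed.

Lemma lottery_unifT (z : Z) : is_lottery (unif R [set: Z]%SET).
Proof. by apply: (@lottery_unif _ _ _ z); rewrite inE. Qed.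

Lemma disagreement_lottery m : is_lottery (disagreement m).
Proof.
apply: lottery_mix; [exact: vanish_itv|exact: lottery_delta|].
exact: lottery_unifT (m player0).2.
Qed.

Lemma disagreement_gt0 m z : 0 < disagreement m z.
Proof. by apply: mix_gt0; [exact: lottery_delta|rewrite unif_gt0 inE]. Qed.

Lemma mechanism_lottery m : is_lottery (mechanism m).
Proof.
rewrite /mechanism; case: pselect => [H|_]; last exact: disagreement_lottery.
by apply: LYhat_lottery; exact: unilateral_LYhat.
Qed.

(** An outer bound, depending only on the messages of the others, on what [i] can induce;
    [objection_attains] approaches it in utility. *)
Definition attainable m i y : Prop :=
  is_lottery y /\ forall th, others_agree m i th -> LYhat u f i (f th) th y.

Lemma mechanism_attainable m i : attainable m i (mechanism m).
Proof.
split=> [|th mi]; first exact: mechanism_lottery.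
by rewrite (mechanism_unilateral mi); exact: unilateral_LYhat.
Qed.

Definition mwith m i (x : message) : 'I_n -> message :=
  @dwith n (fun=> message) m i x.

Lemma mwith_in m i x : mwith m i x i = x. Proof. exact: dwith_in. Qed.

Lemma mwith_out m i x j : j != i -> mwith m i x j = m j.
Proof. by move=> ji; apply: dwith_out; rewrite eq_sym. Qed.

Lemma others_agree_mwith m i x th : others_agree (mwith m i x) i th = others_agree m i th.
Proof.
apply: eq_forallb => j; case: (eqVneq j i) => //= ji; by rewrite mwith_out.
Qed.

(** The same objection works against all profiles: [ts] steers the near-best lottery, [b] the choice
    of the winner, and a large [k] wins and makes the losses small. *)
Lemma objection_attains m i ts b y e : (forall z, u i ts z <= u i ts b) ->
  attainable m i y -> 0 < e -> exists K, forall k, (K <= k)%N ->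
    U u i ts y - e <= U u i ts (mechanism (mwith m i (ts, k, b))).
Proof.
move=> bbest [hy ym] e0.
(* The 1 pays for the tolerance of [near_best], the rest for the perturbation. *)
have B0 : 0 <= 1 + 2 * ubound u i ts by rewrite addr_ge0// mulr_ge0// sumr_ge0.
have [K HK] := vanish_small B0 e0.
have [[th mi]|nmi] := pselect (exists th, others_agree m i th).
  (* A positive [k] makes the message an objection even if [ts = th]. *)
  exists K.+1 => k Kk.
  rewrite (@mechanism_unilateral _ i th) ?others_agree_mwith// mwith_in /unilateral/=.
  rewrite xpair_eqE (gtn_eqF (leq_trans _ Kk)) ?andbF//.
  have [nb1 nb2] := near_bestP i th ts k; have [int1 _ _] := interiorP i th.
  have := nb2 y (ym _ mi).
  have := U_mix_vanish i ts k (LYhat_lottery nb1) (LYhat_lottery int1).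
  by have := HK k (ltnW Kk); lra.
(* An integer above all those in [m] makes [i] the only possible winner. *)
pose K' := (\max_j (m j).1.2)%N.
exists (maxn K K').+1 => k Kk.
have k0 : (0 < k)%N by exact: leq_trans Kk.
have [Kk1 Kk2] : (K <= k)%N /\ (K' < k)%N.
  by move: Kk; rewrite -maxnSS geq_max => /andP[/ltnW].
rewrite mechanism_disagreement; last first.
  move=> j th; apply/negP; have [->|ji] := eqVneq j i.
    by rewrite others_agree_mwith => mi; apply: nmi; exists th.
  (* Agreement among all players but [j] would force the integer of [i] to be 0. *)
  move=> /others_agreeE -/(_ i); rewrite eq_sym => /(_ ji).
  by rewrite mwith_in => -[_ k_0]; rewrite k_0 in k0.
have -> : disagreement (mwith m i (ts, k, b)) =
    mix (vanish k) (delta R b) (unif R [set: Z]%SET).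
  suff wi : winner (mwith m i (ts, k, b)) = i by rewrite /disagreement wi mwith_in.
  rewrite /winner; case: arg_maxnP => // w _ /(_ i isT); rewrite mwith_in /= => kw.
  apply/eqP/negPn/negP => wi; rewrite mwith_out// in kw.
  have : ((m w).1.2 <= K')%N by exact: (leq_bigmax w).
  by rewrite leqNgt (leq_trans Kk2 kw).
have := U_mix_vanish i ts k (lottery_delta R b) (lottery_unifT b).
rewrite U_delta.
have : U u i ts y <= u i ts b by apply: lottery_support_le.
by have := HK k Kk1; have := vanish_gt0 k; lra.
Qed.

(** * Equilibria of the mechanism *)

Notation gm := (mechanism : (forall i : 'I_n, message) -> Z -> R).

(** Otherwise the objections with growing integer would lose nothing in the limit at any profile and
    gain at [m], against [MNE_no_gain]. *)
Lemma MNE_support_best ts lam m i y :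
  MNE u gm ts lam -> 0 < weight lam m -> attainable m i y ->
  U u i ts y <= U u i ts (mechanism m).
Proof.
move=> eql wm ym.
have [b bbest] : exists b, forall z, u i ts z <= u i ts b.
  pose b := [arg max_(b > f ts) u i ts b]%O; exists b => z.
  by rewrite /b; case: arg_maxP => // b' _; exact.
rewrite leNgt; apply/negP => gain.
(* Half of the gap is given up to the approximation, the other half remains as gain. *)
pose d := (U u i ts y - U u i ts (mechanism m)) / 2.
have d0 : 0 < d by rewrite divr_gt0// subr_gt0.
suff w0 : weight lam m = 0 by rewrite w0 ltxx in wm.
apply: (MNE_no_gain mechanism_lottery (x := fun k => (ts, k, b)) eql _ d0).
  by move=> m' e e0; apply: objection_attains => //; exact: mechanism_attainable.
have [K HK] := objection_attains bbest ym d0.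
exists K => k /HK; apply: le_trans; rewrite /d; lra.
Qed.

Definition truthful ts : 'I_n -> message := fun=> (ts, 0%N, f ts).

Lemma truthful_agree ts i : others_agree (truthful ts) i ts.
Proof. by apply/forallP => j; rewrite eqxx implybT. Qed.

Lemma truthful_outcome ts : mechanism (truthful ts) = delta R (f ts).
Proof.
by rewrite (mechanism_unilateral (truthful_agree ts player0)) /unilateral eqxx.
Qed.

Lemma truthful_PNE ts : PNE u gm ts (truthful ts).
Proof.
move=> i x; rewrite truthful_outcome.
have [_ /(_ ts)] := mechanism_attainable (mwith (truthful ts) i x) i.
by rewrite others_agree_mwith => /(_ (truthful_agree ts i))/LYhat_sub[].
Qed.

Hypothesis hf : exists th1 th2 : Theta, f th1 <> f th2.
Hypothesis mono : LYhat_monotonic u f.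

(** At a totally indifferent [ts] all lower contour sets are full, so monotonicity would make [f]
    constant. *)
Lemma not_all_indifferent ts : ~ (forall i z z', u i ts z <= u i ts z').
Proof.
move=> ind; have [th1 [th2]] := hf; apply.
suff E th : f th = f ts by rewrite !E.
apply: mono => i y /LYhat_lottery hy; split=> //; rewrite U_delta.
exact: lottery_support_le.
Qed.

Lemma best_full_support i ts y : is_lottery y -> (forall z, 0 < y z) ->
  (forall z, u i ts z <= U u i ts y) -> forall z z', u i ts z <= u i ts z'.
Proof.
move=> hy y0 ymax z z'.
have E z0 : u i ts z0 = U u i ts y by exact: (lottery_support_max hy).
by rewrite !E.
Qed.

Lemma attainable_disagree m i y : (forall th, ~~ others_agree m i th) ->
  is_lottery y -> attainable m i y.
Proof. by move=> H hy; split=> // th; rewrite (negbTE (H th)). Qed.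

Lemma attainable_agree m i th y : others_agree m i th ->
  LYhat u f i (f th) th y -> attainable m i y.
Proof.
move=> mi hy; split=> [|th' mi']; first exact: LYhat_lottery hy.
have [l [li _]] := exists_third i i.
by have [<-] : (th, 0%N) = (th', 0%N) by rewrite -(others_agreeE mi li) -(others_agreeE mi' li).
Qed.

(* A maximizer of a linear functional over the lower contour set that lies in
   the interior of the simplex and strictly below the indifference hyperplane
   can be moved a little towards any outcome. *)
Lemma best_strict_interior i th ts y :
  LY u i (delta R (f th)) th y -> U u i th y < u i th (f th) ->
  (forall y', LY u i (delta R (f th)) th y' -> U u i ts y' <= U u i ts y) ->
  forall z, u i ts z <= U u i ts y.
Proof.
move=> [hy _] Uy ymax z.
have c0 : 0 < u i th (f th) - U u i th y by rewrite subr_gt0.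
have B0 : 0 <= 2 * ubound u i th by rewrite mulr_ge0// sumr_ge0.
have [K /(_ K (leqnn _)) HK] := vanish_small B0 c0.
have ldelta := lottery_delta R z.
have /ymax : LY u i (delta R (f th)) th (mix (vanish K) y (delta R z)).
  split; first by apply: lottery_mix => //; exact: vanish_itv.
  have := U_le_ubound i th hy; have := U_le_ubound i th ldelta.
  rewrite !U_mix !U_delta !ler_norml => /andP[_ l1] /andP[l2 _].
  by have := vanish_gt0 K; nra.
rewrite U_mix U_delta => h; have v0 := vanish_gt0 K.
rewrite -(ler_pM2l v0); lra.
Qed.

Lemma MNE_support_outcome ts lam m :
  MNE u gm ts lam -> 0 < weight lam m -> mechanism m = delta R (f ts).
Proof.
move=> eql wm.
have best i y : attainable m i y -> U u i ts y <= U u i ts (mechanism m).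
  exact: MNE_support_best eql wm.
have bestZ i z : (forall th, ~~ others_agree m i th) -> u i ts z <= U u i ts (mechanism m).
  move=> H; rewrite -[leLHS]U_delta; apply: best; apply: attainable_disagree => //.
  exact: lottery_delta.
have [[j [th mj]]|nagree] := pselect (exists j th, others_agree m j th); last first.
  have H i th : ~~ others_agree m i th by apply/negP => mi; apply: nagree; exists i, th.
  (* In general disagreement a lottery of full support is best for everybody. *)
  exfalso; apply: (@not_all_indifferent ts) => i; apply: best_full_support.
  - exact: mechanism_lottery.
  - by move=> z; rewrite mechanism_disagreement//; exact: disagreement_gt0.
  - by move=> z; exact: bestZ.
have gE := mechanism_unilateral mj; rewrite /unilateral in gE.
case: eqP gE => [mjth|mjth] gE.
  (* All players report [(th, 0)], so each could attain all of [LYhat] at [th]; optimality of [f th]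
     is the inclusion that monotonicity asks for. *)
  rewrite gE; congr delta; apply: mono => i y hy.
  split; first exact: LYhat_lottery hy.
  rewrite -gE; apply: best; apply: (attainable_agree _ hy).
  apply/forallP => l; apply/implyP => _; apply/eqP.
  by have [->//|lj] := eqVneq l j; exact: others_agreeE mj lj.
(* Once [j] objects, the opponents of any other player disagree, so that every lottery is attainable
   for that player. *)
have disagree i th' : i != j -> ~~ others_agree m i th'.
  move=> ij; apply/negP => mi; have [l [li lj]] := exists_third i j.
  apply: mjth; rewrite (others_agreeE mi) 1?eq_sym//.
  by rewrite -(others_agreeE mj lj) (others_agreeE mi li).
have [nb1 _] := near_bestP j th (m j).1.1 (m j).1.2.
have [int1 int2 int3] := interiorP j th.
have gL : LYhat u f j (f th) th (mechanism m).
  by rewrite (mechanism_unilateral mj); exact: unilateral_LYhat.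
have bestj y : LYhat u f j (f th) th y -> U u j ts y <= U u j ts (mechanism m).
  by move=> hy; apply: best; exact: attainable_agree mj hy.
(* In the degenerate case the objection still yields [f th], which is globally best for the others
   at [ts], while the inclusion for [j] concerns one point. *)
have [d|d] := pselect (degenerate u f j th).
  have gD : mechanism m = delta R (f th) by apply/(LYhat_degenerate _ d).
  rewrite gD; congr delta; apply: mono => i y hy.
  split; first exact: LYhat_lottery hy.
  have [ij|ij] := eqVneq i j.
    by move: hy; rewrite ij => /(LYhat_degenerate _ d) ->.
  rewrite -gD; apply: best; apply: attainable_disagree; last exact: LYhat_lottery hy.
  by move=> th'; exact: disagree.
have gpos z : 0 < interior_lottery j th z -> 0 < mechanism m z.
  by move=> iz; rewrite gE; apply: mix_gt0 => //; exact: LYhat_lottery nb1.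
have bestL y : LY u j (delta R (f th)) th y -> U u j ts y <= U u j ts (mechanism m).
  by move=> /(LYhat_regular _ d) /bestj.
have glot := mechanism_lottery m.
exfalso; have [fmin|nfmin] := pselect (forall z, u j th (f th) <= u j th z).
  (* The outcome has support exactly [LZ], so optimality makes [LZ] a [j]-max set at [ts], against
     nondegeneracy. *)
  apply: (d); split=> //; exists ts; split; first by exists (f th); rewrite in_LZ.
  have Epos z : z \in LZ u j (delta R (f th)) th -> 0 < mechanism m z.
    by move=> zE; apply: gpos; exact: int2.
  split=> [z zE z' z'E|i ij z zE z'].
    have E z0 : z0 \in LZ u j (delta R (f th)) th -> u j ts z0 = U u j ts (mechanism m).
      move=> z0E; apply: (lottery_support_max glot) => //; last exact: Epos.
      move=> z1 gz1; rewrite -[leLHS]U_delta; apply: bestL.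
      split; first exact: lottery_delta.
      have := LY_argmin_support fmin (LYhat_sub gL) gz1.
      by rewrite in_LZ !U_delta.
    by rewrite !E.
  have -> : u i ts z = U u i ts (mechanism m).
    apply: (lottery_support_max glot) => //; last exact: Epos.
    by move=> z1 _; apply: bestZ => th'; exact: disagree.
  by apply: bestZ => th'; exact: disagree.
(* The outcome has full support and lies strictly below the hyperplane of [j], so it is globally
   best for [j] too. *)
have [ipos iU] := int3 nfmin.
apply: (@not_all_indifferent ts) => i; apply: (best_full_support glot).
  by move=> z; apply: gpos; exact: ipos.
have [->|ij] := eqVneq i j; last by move=> z; apply: bestZ => th'; exact: disagree.
apply: (best_strict_interior (LYhat_sub gL)) => //.
rewrite gE U_mix.
have := (LYhat_sub nb1).2; rewrite U_delta.
have /andP[v0 v1] := vanish_itv (m j).1.2; have := vanish_gt0 (m j).1.2.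
by nra.
Qed.

Lemma LYhat_monotonic_double : double_Nash_implementable u f.
Proof.
have MNE_sub ts lam z : MNE u gm ts lam -> 0 < outcome gm lam z -> z = f ts.
  move=> eql /(outcome_gt0 mechanism_lottery eql.1)[m [wm]].
  by rewrite (MNE_support_outcome eql wm) => /delta_gt0.
have out m : outcome gm (dirac_profile R m) = mechanism m.
  exact: (outcome_dirac_profile mechanism_lottery).
exists (fun=> message), gm; split; first exact: mechanism_lottery.
split=> ts z; split.
- by move=> [lam [eql]]; exact: MNE_sub.
- move=> ->; have eqt := PNE_MNE mechanism_lottery (truthful_PNE ts).
  by eexists; split; [exact: eqt|rewrite out truthful_outcome delta_self_gt0].
- move=> [m [eqm gz]]; apply: MNE_sub (PNE_MNE mechanism_lottery eqm) _.
  by rewrite out.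
- move=> ->; exists (truthful ts); split; first exact: truthful_PNE.
  by rewrite truthful_outcome delta_self_gt0.
Qed.

End Mechanism.

Theorem theorem2 (R : realType) (n : nat) (Theta : countType) (Z : finType)
  (u : 'I_n -> Theta -> Z -> R) (f : Theta -> Z)
  (hn : (3 <= n)%N)
  (hf : exists th1 th2 : Theta, f th1 <> f th2) :
  [<-> pure_Nash_implementable u f;
       mixed_Nash_implementable u f;
       double_Nash_implementable u f;
       LYhat_monotonic u f].
Proof.
have double : LYhat_monotonic u f -> double_Nash_implementable u f.
  exact: LYhat_monotonic_double.
have mixed : double_Nash_implementable u f -> mixed_Nash_implementable u f.
  by move=> [M [g [hg [hM _]]]]; exists M, g.
have pure : double_Nash_implementable u f -> pure_Nash_implementable u f.
  by move=> [M [g [hg [_ hP]]]]; exists M, g.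
tfae.
- by move=> /pure_LYhat_monotonic/double/mixed.
- by move=> /mixed_LYhat_monotonic/double.
- by move=> /mixed/mixed_LYhat_monotonic.
- by move=> /double/pure.
Qed.
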